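(* Every braided bimonoidal category $(\mathcal{R},\oplus,0_{\mathcal R},c_\oplus,\otimes,1_{\mathcal R},\beta)$ is a bimonoidal category with anti-involution if one defines $\zeta$ to be the identity functor and $\mu=\beta$. In particular, every bipermutative category is a bimonoidal category with anti-involution with $\zeta=\mathrm{id}$ and $\mu=c_\otimes$, where $c_\otimes$ is the multiplicative twist.
   Context: **Bimonoidal category.** A (strict) bimonoidal category $(\mathcal{R},\oplus,0_{\mathcal R},c_\oplus,\otimes,1_{\mathcal R})$ consists of a permutative category $(\mathcal{R},\oplus,0_{\mathcal R},c_\oplus)$ (strictly associative and unital symmetric monoidal) and a strict monoidal category $(\mathcal{R},\otimes,1_{\mathcal R})$ on the same underlying category, with natural isomorphisms $d_\ell\colon A\otimes B\oplus A'\otimes B\to (A\oplus A')\otimes B$, assumed to be the identity, and $d_r\colon A\otimes B\oplus A\otimes B'\to A\otimes(B\oplus B')$, satisfying the axioms of Elmendorf–Mandell (''Rings, modules and algebras in infinite loop space theory'', Def. 3.3): $0_{\mathcal R}\otimes A=0_{\mathcal R}=A\otimes 0_{\mathcal R}$; $d_\ell,d_r$ are compatible with the associativity of $\oplus$, with $c_\oplus$, and with the associativity of $\otimes$; $(d_r\otimes \mathrm{id})\circ d_\ell=(\mathrm{id}\otimes d_\ell)\circ d_r$ as maps $A\otimes B\otimes C\oplus A\otimes B'\otimes C\to A\otimes(B\oplus B')\otimes C$; and the two ways of going from $A\otimes B\oplus A\otimes B'\oplus A'\otimes B\oplus A'\otimes B'$ to $(A\oplus A')\otimes(B\oplus B')$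 agree (using $\mathrm{id}\oplus c_\oplus\oplus\mathrm{id}$). **Anti-involution.** An anti-involution on $\mathcal R$ is a functor $\zeta\colon\mathcal R\to\mathcal R$ with $\zeta\circ\zeta=\mathrm{id}$ together with natural isomorphisms $\mu_{A,B}\colon\zeta(A\otimes B)\to\zeta(B)\otimes\zeta(A)$ such that: (1) $\zeta$ is strictly symmetric monoidal with respect to $(\oplus,0_{\mathcal R},c_\oplus)$; (2) $\zeta(1_{\mathcal R})=1_{\mathcal R}$ and $\mu_{1_{\mathcal R},A}=\mathrm{id}_{\zeta(A)}=\mu_{A,1_{\mathcal R}}$; (3) $(\mathrm{id}\otimes\mu_{A,B})\circ\mu_{A\otimes B,C}=(\mu_{B,C}\otimes\mathrm{id})\circ\mu_{A,B\otimes C}$; (4) $\mu_{A,B\oplus C}\circ\zeta(d_r)=d_\ell\circ(\mu_{A,B}\oplus\mu_{A,C})$ and $\mu_{A\oplus B,C}\circ\zeta(d_\ell)=d_r\circ(\mu_{A,C}\oplus\mu_{B,C})$. **Braided bimonoidal category.** It consists of a permutative category $(\mathcal R,\oplus,0_{\mathcal R},c_\oplus)$ and a strict braided monoidal category $(\mathcal R,\otimes,1_{\mathcal R},\beta)$ with braiding $\beta^{A,B}\colon A\otimes B\to B\otimes A$, where the left distributivity isomorphism $d_\ell\colon A\otimes B\oplus A'\otimes B\to(A\oplus A')\otimes B$ is the identity and the right distributivity isomorphism $d_r\colon A\otimes B\oplus A\otimes C\to A\otimes(B\oplus C)$ is given in terms of $d_\ell$ and $\beta$ such that $$\beta^{A,B\oplus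 C}\circ d_r=d_\ell\circ(\beta^{A,B}\oplus\beta^{A,C}),\qquad \beta^{B\oplus C,A}\circ d_\ell=d_r\circ(\beta^{B,A}\oplus\beta^{C,A}).$$ In addition $\mathcal R$ satisfies the remaining axioms of a bipermutative category of Elmendorf–Mandell (Def. 3.6), i.e. the axioms of their Def. 3.3 listed above except that the mixed axiom $(d_r\otimes\mathrm{id})\circ d_\ell=(\mathrm{id}\otimes d_\ell)\circ d_r$ is replaced by the displayed compatibility with the multiplicative braiding. A bipermutative category is a braided bimonoidal category whose braiding is symmetric; the symmetry is then denoted $c_\otimes$. *)

(* Defs.v *)
Set Implicit Arguments.
Unset Strict Implicit.
Unset Printing Implicit Defensive.

Declare Scope cat_scope.
Delimit Scope cat_scope with cat.
Open Scope cat_scope.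

Reserved Notation "g ∘ f" (at level 40, left associativity).
Reserved Notation "f ≈ g" (at level 70, no associativity).
Reserved Notation "A ⊕ B" (at level 36, left associativity).
Reserved Notation "A ⊗ B" (at level 34, left associativity).
Reserved Notation "f ⊕₁ g" (at level 36, left associativity).
Reserved Notation "f ⊗₁ g" (at level 34, left associativity).

Record category := Category {
  obj :> Type;
  hom : obj -> obj -> Type;
  idm : forall A, hom A A;
  comp : forall A B C, hom B C -> hom A B -> hom A C;
  comp_idl : forall A B (f : hom A B), comp (idm B) f = f;
  comp_idr : forall A B (f : hom A B), comp f (idm A) = f;
  comp_assoc : forall A B C D (h : hom C D) (g : hom B C) (f : hom A B),
    comp h (comp g f) = comp (comp h g) f
}.

Arguments hom {c} A B.
Arguments idm {c} A.
Arguments comp {c A B C} g f.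
Notation "g ∘ f" := (comp g f) : cat_scope.

(* In a strict structure two morphisms may have sources (or targets) that are
   equal objects without being convertible.  [f ≈ g] is equality of arrows in
   the ordinary sense: same source, same target, same morphism. *)
Inductive arrow_eq (C : category) (A B : C) (f : hom A B) :
    forall A' B' : C, hom A' B' -> Prop :=
  arrow_eq_refl : arrow_eq f f.

Notation "f ≈ g" := (arrow_eq f g) : cat_scope.

(* The identity morphism, seen as a morphism between two equal objects. *)
Definition eqhom (C : category) (A B : C) (e : A = B) : hom A B :=
  match e in _ = B' return hom A B' with eq_refl => idm A end.

Definition is_iso (C : category) (A B : C) (f : hom A B) : Prop :=
  exists g : hom B A, g ∘ f = idm A /\ f ∘ g = idm B.

Record functor (C D : category) := Functor {
  fobj :> C -> D;
  fmap : forall A B : C, hom A B -> hom (fobj A) (fobj B);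
  fmap_id : forall A : C, fmap (idm A) = idm (fobj A);
  fmap_comp : forall (A B E : C) (g : hom B E) (f : hom A B),
    fmap (g ∘ f) = fmap g ∘ fmap f
}.

Arguments fmap {C D} F {A B} f : rename.

Definition id_functor (C : category) : functor C C :=
  @Functor C C (fun A => A) (fun A B f => f)
    (fun A => eq_refl) (fun A B E g f => eq_refl).

Definition comp_functor (C D E : category) (G : functor D E) (F : functor C D) :
  functor C E :=
  @Functor C E (fun A => G (F A)) (fun A B f => fmap G (fmap F f))
    (fun A => eq_trans (f_equal (fmap G) (fmap_id F A)) (fmap_id G (F A)))
    (fun A B X g f => eq_trans (f_equal (fmap G) (fmap_comp F g f))
                               (fmap_comp G (fmap F g) (fmap F f))).

Definition functor_eq (C D : category) (F G : functor C D) : Prop :=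
  (forall A : C, F A = G A) /\
  (forall (A B : C) (f : hom A B), fmap F f ≈ fmap G f).

Record strict_monoidal (C : category) := StrictMonoidal {
  tens : C -> C -> C;
  tensm : forall A A' B B' : C,
    hom A A' -> hom B B' -> hom (tens A B) (tens A' B');
  unit_obj : C;
  tensm_id : forall A B : C, tensm (idm A) (idm B) = idm (tens A B);
  tensm_comp : forall (A A' A'' B B' B'' : C)
      (f' : hom A' A'') (f : hom A A') (g' : hom B' B'') (g : hom B B'),
    tensm (f' ∘ f) (g' ∘ g) = tensm f' g' ∘ tensm f g;
  tens_assoc : forall A B D : C, tens A (tens B D) = tens (tens A B) D;
  tensm_assoc : forall (A A' B B' D D' : C)
      (f : hom A A') (g : hom B B') (h : hom D D'),
    tensm f (tensm g h) ≈ tensm (tensm f g) h;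
  tens_unitl : forall A : C, tens unit_obj A = A;
  tensm_unitl : forall (A A' : C) (f : hom A A'), tensm (idm unit_obj) f ≈ f;
  tens_unitr : forall A : C, tens A unit_obj = A;
  tensm_unitr : forall (A A' : C) (f : hom A A'), tensm f (idm unit_obj) ≈ f
}.

Arguments tens {C} s A B.
Arguments tensm {C} s {A A' B B'} f g.
Arguments unit_obj {C} s.
Arguments tens_assoc {C} s A B D.

Definition swap (C : category) (M : strict_monoidal C) : Type :=
  forall A B : C, hom (tens M A B) (tens M B A).

(* The hexagons with identity associators, up to the [eqhom] that reassociates
   the intermediate object.  The unit conditions b A 1 = id = b 1 A are
   consequences of the hexagons and of invertibility. *)
Record is_braiding (C : category) (M : strict_monoidal C) (b : swap M) : Prop := {
  braid_iso : forall A B : C, is_iso (b A B);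
  braid_nat : forall (A A' B B' : C) (f : hom A A') (g : hom B B'),
    b A' B' ∘ tensm M f g = tensm M g f ∘ b A B;
  braid_hex_r : forall A B D : C,
    b A (tens M B D) ≈
    tensm M (idm B) (b A D) ∘ eqhom (eq_sym (tens_assoc M B A D))
      ∘ tensm M (b A B) (idm D);
  braid_hex_l : forall A B D : C,
    b (tens M A B) D ≈
    tensm M (b A D) (idm B) ∘ eqhom (tens_assoc M A D B)
      ∘ tensm M (idm A) (b B D)
}.

Record is_symmetry (C : category) (M : strict_monoidal C) (b : swap M) : Prop := {
  symm_braid : is_braiding b;
  symm_inv : forall A B : C, b B A ∘ b A B = idm (tens M A B)
}.

Record permutative (C : category) := Permutative {
  perm_mon :> strict_monoidal C;
  perm_c : swap perm_mon;
  perm_symm : is_symmetry perm_c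
}.

Arguments perm_c {C} p A B.

(* The data common to bimonoidal and braided bimonoidal categories: the two
   monoidal structures and the distributivity maps.  That the left
   distributivity is the identity is recorded as an equality of objects. *)
Record distrib_data := DistribData {
  base :> category;
  add : permutative base;
  mul : strict_monoidal base;
  dl_obj : forall A A' B : base,
    tens add (tens mul A B) (tens mul A' B) = tens mul (tens add A A') B;
  dr : forall A B B' : base,
    hom (tens add (tens mul A B) (tens mul A B')) (tens mul A (tens add B B'))
}.

Arguments add : clear implicits.
Arguments mul : clear implicits.
Arguments dr {d} A B B'.

Section Distributivity.

Variable R : distrib_data.

Local Notation "A ⊕ B" := (tens (add R) A B) : cat_scope.
Local Notation "A ⊗ B" := (tens (mul R) A B) : cat_scope.
Local Notation "f ⊕₁ g" := (tensm (add R) f g) : cat_scope.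
Local Notation "f ⊗₁ g" := (tensm (mul R) f g) : cat_scope.
Local Notation "0" := (unit_obj (add R)) : cat_scope.
Local Notation "1" := (unit_obj (mul R)) : cat_scope.
Local Notation c := (perm_c (add R)).

Definition dl (A A' B : R) : hom (A ⊗ B ⊕ A' ⊗ B) ((A ⊕ A') ⊗ B) :=
  eqhom (dl_obj A A' B).

Lemma add_reassoc4 (W X Y Z : R) : W ⊕ (X ⊕ Y ⊕ Z) = (W ⊕ X) ⊕ (Y ⊕ Z).
Proof.
rewrite <- (tens_assoc (add R) X Y Z).
apply tens_assoc.
Qed.

(* id ⊕ c ⊕ id on a fourfold sum *)
Definition interchange (W X Y Z : R) :
    hom ((W ⊕ X) ⊕ (Y ⊕ Z)) ((W ⊕ Y) ⊕ (X ⊕ Z)) :=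
  eqhom (add_reassoc4 W Y X Z) ∘ (idm W ⊕₁ (c X Y ⊕₁ idm Z))
    ∘ eqhom (eq_sym (add_reassoc4 W X Y Z)).

(* The Elmendorf-Mandell axioms shared by both notions, i.e. all of them except
   the one relating dl and dr through a triple product. *)
Record is_distributive : Prop := {
  dl_nat : forall (A A1 A' A1' B B1 : R)
      (f : hom A A1) (f' : hom A' A1') (g : hom B B1),
    dl A1 A1' B1 ∘ (f ⊗₁ g ⊕₁ f' ⊗₁ g) = ((f ⊕₁ f') ⊗₁ g) ∘ dl A A' B;
  dr_nat : forall (A A1 B B1 B' B1' : R)
      (f : hom A A1) (g : hom B B1) (g' : hom B' B1'),
    dr A1 B1 B1' ∘ (f ⊗₁ g ⊕₁ f ⊗₁ g') = (f ⊗₁ (g ⊕₁ g')) ∘ dr A B B';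
  dr_iso : forall A B B' : R, is_iso (dr A B B');

  mul_0l : forall A : R, 0 ⊗ A = 0;
  mul_0r : forall A : R, A ⊗ 0 = 0;

  dl_add_assoc : forall A A' A'' B : R,
    dl (A ⊕ A') A'' B ∘ (dl A A' B ⊕₁ idm (A'' ⊗ B)) ≈
    dl A (A' ⊕ A'') B ∘ (idm (A ⊗ B) ⊕₁ dl A' A'' B);
  dr_add_assoc : forall A B B' B'' : R,
    dr A (B ⊕ B') B'' ∘ (dr A B B' ⊕₁ idm (A ⊗ B'')) ≈
    dr A B (B' ⊕ B'') ∘ (idm (A ⊗ B) ⊕₁ dr A B' B'');

  dl_add_comm : forall A A' B : R,
    dl A' A B ∘ c (A ⊗ B) (A' ⊗ B) = (c A A' ⊗₁ idm B) ∘ dl A A' B;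
  dr_add_comm : forall A B B' : R,
    dr A B' B ∘ c (A ⊗ B) (A ⊗ B') = (idm A ⊗₁ c B B') ∘ dr A B B';

  dl_mul_assoc : forall A A' B D : R,
    (dl A A' B ⊗₁ idm D) ∘ dl (A ⊗ B) (A' ⊗ B) D ≈ dl A A' (B ⊗ D);
  dr_mul_assoc : forall A B D D' : R,
    (idm A ⊗₁ dr B D D') ∘ dr A (B ⊗ D) (B ⊗ D') ≈ dr (A ⊗ B) D D';

  dl_dr_square : forall A A' B B' : R,
    dl A A' (B ⊕ B') ∘ (dr A B B' ⊕₁ dr A' B B') =
    dr (A ⊕ A') B B' ∘ (dl A A' B ⊕₁ dl A A' B')
      ∘ interchange (A ⊗ B) (A ⊗ B') (A' ⊗ B) (A' ⊗ B')
}.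

Record is_bimonoidal : Prop := {
  bimon_distributive : is_distributive;
  dl_dr_mixed : forall A B B' D : R,
    (dr A B B' ⊗₁ idm D) ∘ dl (A ⊗ B) (A ⊗ B') D ≈
    (idm A ⊗₁ dl B B' D) ∘ dr A (B ⊗ D) (B' ⊗ D)
}.

Record is_anti_involution (z : functor R R)
    (mu : forall A B : R, hom (z (A ⊗ B)) (z B ⊗ z A)) : Prop := {
  anti_involutive : functor_eq (comp_functor z z) (id_functor R);
  anti_iso : forall A B : R, is_iso (mu A B);
  anti_nat : forall (A A' B B' : R) (f : hom A A') (g : hom B B'),
    mu A' B' ∘ fmap z (f ⊗₁ g) = (fmap z g ⊗₁ fmap z f) ∘ mu A B;

  anti_add : forall A B : R, z (A ⊕ B) = z A ⊕ z B;
  anti_addm : forall (A A' B B' : R) (f : hom A A') (g : hom B B'),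
    fmap z (f ⊕₁ g) ≈ fmap z f ⊕₁ fmap z g;
  anti_0 : z 0 = 0;
  anti_c : forall A B : R, fmap z (c A B) ≈ c (z A) (z B);

  anti_1 : z 1 = 1;
  anti_mu_1l : forall A : R, mu 1 A ≈ idm (z A);
  anti_mu_1r : forall A : R, mu A 1 ≈ idm (z A);

  anti_mu_assoc : forall A B D : R,
    (idm (z D) ⊗₁ mu A B) ∘ mu (A ⊗ B) D ≈
    (mu B D ⊗₁ idm (z A)) ∘ mu A (B ⊗ D);

  anti_mu_dr : forall A B D : R,
    mu A (B ⊕ D) ∘ fmap z (dr A B D) ≈
    dl (z B) (z D) (z A) ∘ (mu A B ⊕₁ mu A D);
  anti_mu_dl : forall A B D : R,
    mu (A ⊕ B) D ∘ fmap z (dl A B D) ≈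
    dr (z D) (z A) (z B) ∘ (mu A D ⊕₁ mu B D)
}.

Definition is_bimonoidal_with_anti_involution (z : functor R R)
    (mu : forall A B : R, hom (z (A ⊗ B)) (z B ⊗ z A)) : Prop :=
  is_bimonoidal /\ is_anti_involution mu.

Record is_braided_bimonoidal (b : swap (mul R)) : Prop := {
  brbimon_distributive : is_distributive;
  brbimon_braiding : is_braiding b;
  braid_dr : forall A B D : R,
    b A (B ⊕ D) ∘ dr A B D = dl B D A ∘ (b A B ⊕₁ b A D);
  braid_dl : forall A B D : R,
    b (B ⊕ D) A ∘ dl B D A = dr A B D ∘ (b B A ⊕₁ b D A)
}.

Record is_bipermutative (b : swap (mul R)) : Prop := {
  biperm_braided : is_braided_bimonoidal b;
  biperm_symm : is_symmetry b
}.

End Distributivity.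

Arguments is_anti_involution : clear implicits.
Arguments is_bimonoidal_with_anti_involution : clear implicits.
Arguments is_braided_bimonoidal : clear implicits.
Arguments is_bipermutative : clear implicits.

(* Main.v *)
(* Only the mixed axiom, the associativity of [mu] and its unitality need an
   argument; the rest of the structure is literally part of the braided one.

   Since [dl] is the identity, its naturality says that
   [f ⊗ g ⊕ f' ⊗ g = (f ⊕ f') ⊗ g], and the mixed axiom reads
   [dr A B B' ⊗ D = dr A (B ⊗ D) (B' ⊗ D)].  It is enough to check this after
   composing with the isomorphism [b A ((B ⊕ B') ⊗ D)], which by the hexagon is
   [b A (B ⊕ B') ⊗ D] followed by [(B ⊕ B') ⊗ b A D].  Because
   [b A (X ⊕ Y) ∘ dr A X Y = b A X ⊕ b A Y], the left-hand side becomes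
   [(b A B ⊕ b A B') ⊗ D] followed by [(B ⊕ B') ⊗ b A D], and the right-hand side
   becomes [b A (B ⊗ D) ⊕ b A (B' ⊗ D)]; these agree by the hexagon in each
   summand.  The associativity of [mu = b] is the Yang-Baxter equation. *)
From Stdlib Require Import Eqdep.
Require Import Defs.

Set Implicit Arguments.
Unset Strict Implicit.

Lemma arrow_eq_sym (C : category) (A B A' B' : C) (f : hom A B) (f' : hom A' B') :
  f ≈ f' -> f' ≈ f.
Proof. intros []. constructor. Qed.

Lemma arrow_eq_trans (C : category) (A B A' B' A'' B'' : C)
    (f : hom A B) (g : hom A' B') (h : hom A'' B'') :
  f ≈ g -> g ≈ h -> f ≈ h.
Proof. intros [] []. constructor. Qed.

Lemma eq_arrow_eq (C : category) (A B : C) (f g : hom A B) : f = g -> f ≈ g.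
Proof. intros []. constructor. Qed.

(** Makes the endpoint equalities explicit, so that they can be destructed one at a time. *)
Lemma arrow_eqE (C : category) (A B A' B' : C) (f : hom A B) (f' : hom A' B') :
  f ≈ f' -> exists (eA : A' = A) (eB : B = B'), f' = eqhom eB ∘ f ∘ eqhom eA.
Proof.
intros []. exists eq_refl, eq_refl. simpl.
now rewrite comp_idr, comp_idl.
Qed.

(* Objects form an arbitrary type, so this needs uniqueness of identity proofs:
   the equality of the middle objects comes once from [f ≈ f'] and once from
   [g ≈ g']. *)
Lemma comp_arrow_eq (C : category) (A B D A' B' D' : C)
    (g : hom B D) (g' : hom B' D') (f : hom A B) (f' : hom A' B') :
  g ≈ g' -> f ≈ f' -> g ∘ f ≈ g' ∘ f'.
Proof.
intros Hg Hf.
destruct (arrow_eqE Hg) as (e1 & e2 & ->).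
destruct (arrow_eqE Hf) as (e3 & e4 & ->).
destruct e2, e3, e4.
rewrite (UIP_refl _ _ e1). simpl.
rewrite !comp_idl, !comp_idr. constructor.
Qed.

Lemma tensm_arrow_eq (C : category) (M : strict_monoidal C)
    (A B A' B' D E D' E' : C)
    (f : hom A B) (f' : hom A' B') (g : hom D E) (g' : hom D' E') :
  f ≈ f' -> g ≈ g' -> tensm M f g ≈ tensm M f' g'.
Proof. intros [] []. constructor. Qed.

Lemma idm_arrow_eq (C : category) (A A' : C) : A = A' -> idm A ≈ idm A'.
Proof. intros []. constructor. Qed.

Lemma comp_eqhom_l (C : category) (A B D : C) (e : B = D) (f : hom A B) :
  eqhom e ∘ f ≈ f.
Proof. destruct e. simpl. rewrite comp_idl. constructor. Qed.

Lemma comp_eqhom_r (C : category) (A B D : C) (e : A = B) (f : hom B D) :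
  f ∘ eqhom e ≈ f.
Proof. destruct e. simpl. rewrite comp_idr. constructor. Qed.

Lemma comp3_arrow_eq (C : category) (A B B1 D A' B' B1' D' : C)
    (g : hom B1 D) (g' : hom B1' D') (e : B = B1) (e' : B' = B1')
    (f : hom A B) (f' : hom A' B') :
  g ≈ g' -> f ≈ f' -> g ∘ eqhom e ∘ f ≈ g' ∘ eqhom e' ∘ f'.
Proof.
intros Hg Hf. apply comp_arrow_eq; [|exact Hf].
destruct e, e'. simpl. rewrite !comp_idr. exact Hg.
Qed.

Lemma iso_cancel_l (C : category) (A B D A' B' D' : C)
    (h : hom B D) (h' : hom B' D') (f : hom A B) (f' : hom A' B') :
  is_iso h -> h ≈ h' -> h ∘ f ≈ h' ∘ f' -> f ≈ f'.
Proof.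
intros [k [Hk _]] H. destruct H. intros H.
assert (E : k ∘ (h ∘ f) ≈ k ∘ (h ∘ f'))
  by (apply comp_arrow_eq; [constructor | exact H]).
rewrite !comp_assoc, Hk, !comp_idl in E. exact E.
Qed.

(** An invertible idempotent is an identity: cancel [f] on the left. Here [e] bridges endpoints that
    are equal but perhaps not convertible. *)
Lemma iso_idempotent_id (C : category) (A B : C) (f : hom A B) (e : B = A) :
  is_iso f -> f ≈ f ∘ eqhom e ∘ f -> f ≈ idm A.
Proof.
destruct e. simpl. rewrite comp_idr. intros Hf H.
apply arrow_eq_sym, (iso_cancel_l Hf (arrow_eq_refl f)).
now rewrite comp_idr.
Qed.

Section Braiding.

Variables (C : category) (M : strict_monoidal C) (b : swap M).
Hypothesis hb : is_braiding b.

Lemma swap_arrow_eq (A A' B B' : C) : A = A' -> B = B' -> b A B ≈ b A' B'.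
Proof. intros [] []. constructor. Qed.

(** Writing the unit as a product of two units turns the hexagon into idempotence of this
    braiding. *)
Lemma braid_unit_l (A : C) : b (unit_obj M) A ≈ idm A.
Proof.
set (e := eq_trans (tens_unitr M A) (eq_sym (tens_unitl M A))).
apply arrow_eq_trans with (g := idm (tens M (unit_obj M) A));
  [|apply idm_arrow_eq, tens_unitl].
apply (iso_idempotent_id (e := e)); [apply (braid_iso hb)|].
eapply arrow_eq_trans;
  [exact (swap_arrow_eq (eq_sym (tens_unitl M (unit_obj M))) (eq_refl A))|].
eapply arrow_eq_trans; [apply (braid_hex_l hb)|].
apply comp3_arrow_eq; [apply tensm_unitr | apply tensm_unitl].
Qed.

Lemma braid_unit_r (A : C) : b A (unit_obj M) ≈ idm A.
Proof.
set (e := eq_trans (tens_unitl M A) (eq_sym (tens_unitr M A))).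
apply arrow_eq_trans with (g := idm (tens M A (unit_obj M)));
  [|apply idm_arrow_eq, tens_unitr].
apply (iso_idempotent_id (e := e)); [apply (braid_iso hb)|].
eapply arrow_eq_trans;
  [exact (swap_arrow_eq (eq_refl A) (eq_sym (tens_unitl M (unit_obj M))))|].
eapply arrow_eq_trans; [apply (braid_hex_r hb)|].
apply comp3_arrow_eq; [apply tensm_unitl | apply tensm_unitr].
Qed.

(** By naturality the right side is [b A (D ⊗ B)] after [A ⊗ b B D]. Expanding the left side by one
    hexagon gives the same last factor, and the other hexagon identifies what remains. *)
Lemma yang_baxter (A B D : C) :
  tensm M (idm D) (b A B) ∘ b (tens M A B) D ≈
  tensm M (b B D) (idm A) ∘ b A (tens M B D).
Proof.
rewrite <- (braid_nat hb (idm A) (b B D)).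
eapply arrow_eq_trans.
{ apply comp_arrow_eq; [|apply (braid_hex_l hb)].
  apply arrow_eq_sym, (comp_eqhom_r (eq_sym (tens_assoc M D A B))). }
rewrite !comp_assoc.
apply comp_arrow_eq; [|constructor].
eapply arrow_eq_trans; [apply comp_eqhom_r|].
apply arrow_eq_sym, (braid_hex_r hb).
Qed.

End Braiding.

Section BraidedBimonoidal.

Variables (R : distrib_data) (b : swap (mul R)).
Hypothesis hR : is_braided_bimonoidal R b.

Local Notation "A ⊕ B" := (tens (add R) A B) : cat_scope.
Local Notation "A ⊗ B" := (tens (mul R) A B) : cat_scope.
Local Notation "f ⊕₁ g" := (tensm (add R) f g) : cat_scope.
Local Notation "f ⊗₁ g" := (tensm (mul R) f g) : cat_scope.

Lemma tensm_dl (A A1 A' A1' B B1 : R)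
    (f : hom A A1) (f' : hom A' A1') (g : hom B B1) :
  f ⊗₁ g ⊕₁ f' ⊗₁ g ≈ (f ⊕₁ f') ⊗₁ g.
Proof.
eapply arrow_eq_trans; [apply arrow_eq_sym, (comp_eqhom_l (dl_obj A1 A1' B1))|].
fold (dl A1 A1' B1).
rewrite (dl_nat (brbimon_distributive hR)).
apply comp_eqhom_r.
Qed.

(** Merges the reassociations from the hexagons of two summands into a single one. *)
Lemma tensm_eqhom (A A' B B' : R) (e : A = A') (e' : B = B') :
  exists e'' : A ⊕ B = A' ⊕ B', eqhom e ⊕₁ eqhom e' = eqhom e''.
Proof. destruct e, e'. exists eq_refl. apply tensm_id. Qed.

Lemma tensm_dr (A B B' D : R) :
  dr A B B' ⊗₁ idm D ≈ dr A (B ⊗ D) (B' ⊗ D).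
Proof.
pose proof (brbimon_braiding hR) as hb.
(* [e] rebrackets the target of [dr A B B' ⊗₁ idm D] to match the source of the braiding. *)
set (e := eq_sym (tens_assoc (mul R) A (B ⊕ B') D)).
eapply arrow_eq_trans; [apply arrow_eq_sym, (comp_eqhom_l e)|].
apply (iso_cancel_l (h := b A ((B ⊕ B') ⊗ D)) (h' := b A (B ⊗ D ⊕ B' ⊗ D)));
  [apply (braid_iso hb)
  |apply swap_arrow_eq; [reflexivity | symmetry; apply dl_obj]|].
rewrite (braid_dr hR).
(* The hexagon brings [b A (B ⊕ B')] next to [dr A B B'], where [braid_dr] applies. *)
apply arrow_eq_trans with
  (g := (idm (B ⊕ B') ⊗₁ b A D)
          ∘ eqhom (eq_sym (tens_assoc (mul R) (B ⊕ B') A D))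
          ∘ ((b A (B ⊕ B') ∘ dr A B B') ⊗₁ idm D)).
{ rewrite <- (comp_idl (idm D)), tensm_comp, !comp_assoc, comp_idl.
  apply comp_arrow_eq; [|constructor].
  eapply arrow_eq_trans; [apply comp_eqhom_r | apply (braid_hex_r hb)]. }
rewrite (braid_dr hR).
apply arrow_eq_sym.
eapply arrow_eq_trans; [apply comp_eqhom_l|].
eapply arrow_eq_trans;
  [apply tensm_arrow_eq; apply (braid_hex_r hb)|].
rewrite !tensm_comp.
destruct (tensm_eqhom (eq_sym (tens_assoc (mul R) B A D))
            (eq_sym (tens_assoc (mul R) B' A D))) as [e' ->].
apply comp3_arrow_eq.
- rewrite <- tensm_id. apply tensm_dl.
- eapply arrow_eq_trans; [apply tensm_dl|].
  apply tensm_arrow_eq; [|constructor].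
  apply arrow_eq_sym, comp_eqhom_l.
Qed.

Lemma braided_is_bimonoidal : is_bimonoidal R.
Proof.
split; [exact (brbimon_distributive hR)|].
intros A B B' D.
eapply arrow_eq_trans; [apply comp_eqhom_r|].
eapply arrow_eq_trans; [apply tensm_dr|].
assert (E : idm A ⊗₁ dl B B' D ≈ idm (A ⊗ (B ⊗ D ⊕ B' ⊗ D))).
{ unfold dl. destruct (dl_obj B B' D). simpl.
  apply eq_arrow_eq, tensm_id. }
apply arrow_eq_sym.
eapply arrow_eq_trans; [apply comp_arrow_eq; [exact E | constructor]|].
apply eq_arrow_eq, comp_idl.
Qed.

Lemma braiding_is_anti_involution : is_anti_involution R (id_functor R) b.
Proof.
pose proof (brbimon_braiding hR) as hb.
split; simpl; intros; try reflexivity; try constructor.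
(* The first two goals are the object and morphism parts of [functor_eq]. *)
- reflexivity.
- constructor.
- apply (braid_iso hb).
- apply (braid_nat hb).
- apply (braid_unit_l hb).
- apply (braid_unit_r hb).
- apply (yang_baxter hb).
- apply eq_arrow_eq, (braid_dr hR).
- apply eq_arrow_eq, (braid_dl hR).
Qed.

End BraidedBimonoidal.

Theorem proposition5p4 :
  (forall (R : distrib_data) (beta : swap (mul R)),
     is_braided_bimonoidal R beta ->
     is_bimonoidal_with_anti_involution R (id_functor R) beta) /\
  (forall (R : distrib_data) (c_mul : swap (mul R)),
     is_bipermutative R c_mul ->
     is_bimonoidal_with_anti_involution R (id_functor R) c_mul).
Proof.
assert (H : forall (R : distrib_data) (beta : swap (mul R)),
     is_braided_bimonoidal R beta ->
     is_bimonoidal_with_anti_involution R (id_functor R) beta).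
{ intros R beta hR. split.
  - exact (braided_is_bimonoidal hR).
  - exact (braiding_is_anti_involution hR). }
split; [exact H|].
intros R c_mul [hR _]. exact (H R c_mul hR).
Qed.
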